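(* Let $I$ be a finite index set, $f:\mathbb{R}^n\to\overline{\mathbb{R}}$, let $g_j:\mathbb{R}^n\to\overline{\mathbb{R}}$ ($j\in I$), suppose $\Omega:=\{x\in\mathbb{R}^n: g_j(x)\le0\ \forall j\in I\}$ is a closed convex set, let $\bar x\in\Omega\cap\mathrm{dom}\,f$ and $I(\bar x)=\{j\in I: g_j(\bar x)=0\}$. Let $K_j\subset\mathbb{R}^n$, $\beta_j>0$, $\gamma_j\ge0$. Suppose there exist scalars $\gamma_0\ge0$, $\mu_j\ge0$ ($j\in I(\bar x)$) and vectors $v\in\partial f(\bar x)$, $v^\infty\in\partial^\infty f(\bar x)$, $v_j\in\partial^{K_j}_{\beta_j,\gamma_j}g_j(\bar x)$ (if $\mu_j>0$) and $v_j^\infty\in\partial^\infty g_j(\bar x)$ (if $\mu_j=0$) such that $\gamma_0+\sum_{j\in I(\bar x)}\mu_j=1$ and $$0=\gamma_0v+\widehat\gamma_0v^\infty+\sum_{j\in I(\bar x):\,\mu_j>0}\mu_jv_j+\sum_{j\in I(\bar x):\,\mu_j=0}v_j^\infty,$$ where $\widehat\gamma_0=1$ if $\gamma_0=0$ and $\widehat\gamma_0=0$ if $\gamma_0>0$. Suppose further that $\Omega\subset\bigcap_{j\in I(\bar x)}K_j$ and that, for every $j\in I(\bar x)$, $g_j$ is proper and strongly quasiconvex with modulus $\gamma_j\ge0$ and $S_{g_j}(\cdot)$ is inner semicontinuous at $\bar x$. Then there exists an open convex neighborhood $V$ of $\bar x$ such that $$\bar\mu\,\|y-\bar x\|^2\le\gamma_0\langle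 v,y-\bar x\rangle+\widehat\gamma_0\langle v^\infty,y-\bar x\rangle\quad\forall y\in\Omega\cap V,\qquad\bar\mu:=\frac12\sum_{j\in I(\bar x):\,\mu_j>0}\beta_j\gamma_j\mu_j .$$ Further, if $\gamma_0>0$ (i.e. $\bar x$ is a generalized KKT point), then $$\frac{1}{\gamma_0}\bar\mu\,\|y-\bar x\|^2\le\langle v,y-\bar x\rangle\quad\forall y\in\Omega\cap V .$$
   Context: $\overline{\mathbb{R}}=\mathbb{R}\cup\{\pm\infty\}$; $\mathrm{dom}\,h=\{x: h(x)<+\infty\}$; $h$ is proper if $\mathrm{dom}\,h\neq\emptyset$ and $h>-\infty$ everywhere; $S_h(x)=\{y\in\mathbb{R}^n: h(y)\le h(x)\}$. An empty sum is $0$. Strong subdifferential: for nonempty $K\subset\mathbb{R}^n$, $\beta>0$, $\gamma\ge 0$ and $\bar x\in\mathrm{dom}\,h\cap K$, $\partial^K_{\beta,\gamma}h(\bar x)$ is the set of all $\xi\in\mathbb{R}^n$ such that for all $y\in K$ and all $\lambda\in[0,1]$ $$\max\{h(y),h(\bar x)\}\ge h(\bar x)+\frac{\lambda}{\beta}\langle\xi,y-\bar x\rangle+\frac{\lambda}{2}\Big(\gamma-\frac{\lambda}{\beta}-\lambda\gamma\Big)\|y-\bar x\|^2 .$$ A function $h$ with convex domain is strongly quasiconvex with modulus $\gamma\ge0$ if $h(\lambda y+(1-\lambda)x)\le\max\{h(y),h(x)\}-\lambda(1-\lambda)\frac{\gamma}{2}\|x-y\|^2$ for all $x,y\in\mathrm{dom}\,h$,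 $\lambda\in[0,1]$. $S_h(\cdot)$ is inner semicontinuous at $\bar x$ if for every $y\in S_h(\bar x)$ and every sequence $x^k\to\bar x$ with $x^k\in\mathrm{dom}\,h$ there exist $y^k\to y$ with $y^k\in S_h(x^k)$ for all $k$. Regular subdifferential: $\widehat\partial h(x)=\{v: h(y)\ge h(x)+\langle v,y-x\rangle+o(\|y-x\|)\ \forall y\in\mathbb{R}^n\}$ for $x\in\mathrm{dom}\,h$, and $\emptyset$ otherwise. Limiting subdifferential: $\partial h(\bar x)=\{v:\exists\,x^k\to\bar x$ with $h(x^k)\to h(\bar x)$ and $v^k\in\widehat\partial h(x^k)$ with $v^k\to v\}$. Horizon subdifferential: $\partial^\infty h(\bar x)=\{v:\exists\,x^k\to\bar x$ with $h(x^k)\to h(\bar x)$, $v^k\in\widehat\partial h(x^k)$ and $t_k\to0^+$ with $t_kv^k\to v\}$ (possibly empty). *)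

(* Defs.v *)
From HB Require Import structures.
From mathcomp Require Import all_boot all_order all_algebra.
From mathcomp Require Import all_classical all_reals all_analysis.

Set Implicit Arguments.
Unset Strict Implicit.
Unset Printing Implicit Defensive.

Import Order.TTheory GRing.Theory Num.Theory.
Import numFieldNormedType.Exports.

Local Open Scope classical_set_scope.
Local Open Scope ring_scope.

(* R^n is 'rV[R]_n.  The norm that mathcomp-analysis puts on 'rV[R]_n is the
   sup norm: it is used here only through the topology it induces (which is
   the Euclidean one), whereas all quantitative statements use [enorm]. *)
Section Euclidean.
Context {R : realType} {n : nat}.

Definition dot (u v : 'rV[R]_n) : R := \sum_(i < n) u 0 i * v 0 i.

Definition enorm (u : 'rV[R]_n) : R := Num.sqrt (dot u u).

End Euclidean.

Section ExtendedRealValued.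
Context {R : realType} {n : nat}.
Implicit Types (h : 'rV[R]_n -> \bar R) (x y v xi : 'rV[R]_n).

Definition dom h : set 'rV[R]_n := [set x | (h x < +oo)%E].

Definition proper_fun h : Prop := dom h !=set0 /\ forall x, (-oo < h x)%E.

(* S_h(x) *)
Definition sublevel h x : set 'rV[R]_n := [set y | (h y <= h x)%E].

Definition strongly_quasiconvex (gamma : R) h : Prop :=
  convex_set (dom h) /\
  forall x y (lambda : R), dom h x -> dom h y -> 0 <= lambda <= 1 ->
    (h (lambda *: y + (1 - lambda) *: x)%R
     <= maxe (h y) (h x)
        - (lambda * (1 - lambda) * (gamma / 2) * enorm (x - y) ^+ 2)%:E)%E.

Definition sublevel_inner_semicontinuous h (xbar : 'rV[R]_n) : Prop :=
  forall y, sublevel h xbar y ->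
  forall x_ : nat -> 'rV[R]_n,
    x_ @ \oo --> xbar -> (forall k, dom h (x_ k)) ->
  exists y_ : nat -> 'rV[R]_n,
    y_ @ \oo --> y /\ forall k, sublevel h (x_ k) (y_ k).

(* This is only meaningful for [xbar] in [dom h `&` K]; it is taken to be
   empty elsewhere. *)
Definition strong_subdiff (K : set 'rV[R]_n) (beta gamma : R) h
    (xbar : 'rV[R]_n) : set 'rV[R]_n :=
  [set xi | [/\ dom h xbar, K xbar &
    forall y (lambda : R), K y -> 0 <= lambda <= 1 ->
    (h xbar + (lambda / beta * dot xi (y - xbar)
               + lambda / 2 * (gamma - lambda / beta - lambda * gamma)
                 * enorm (y - xbar) ^+ 2)%:E
     <= maxe (h y) (h xbar))%E]].

(* [r] is the remainder o(|y - x|).  It is allowed to take infinite values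
   away from [x], so that the inequality, although required for all [y], is
   not obstructed by [h] being -oo at points far from [x]. *)
Definition regular_subdiff h x : set 'rV[R]_n :=
  [set v | dom h x /\
    exists r : 'rV[R]_n -> \bar R,
      (forall e : R, 0 < e ->
         \forall y \near x, (`|r y| <= (e * enorm (y - x))%:E)%E) /\
      forall y, (h x + (dot v (y - x))%:E + r y <= h y)%E].

Definition limiting_subdiff h (xbar : 'rV[R]_n) : set 'rV[R]_n :=
  [set v | exists (x_ v_ : nat -> 'rV[R]_n),
    [/\ x_ @ \oo --> xbar,
        (fun k => h (x_ k)) @ \oo --> h xbar,
        forall k, regular_subdiff h (x_ k) (v_ k) &
        v_ @ \oo --> v]].

Definition horizon_subdiff h (xbar : 'rV[R]_n) : set 'rV[R]_n :=
  [set v | exists (x_ v_ : nat -> 'rV[R]_n) (t_ : nat -> R),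
    [/\ x_ @ \oo --> xbar /\ (fun k => h (x_ k)) @ \oo --> h xbar,
        forall k, regular_subdiff h (x_ k) (v_ k),
        forall k, 0 < t_ k,
        t_ @ \oo --> (0 : R) &
        (fun k => t_ k *: v_ k) @ \oo --> v]].

End ExtendedRealValued.

Section Constraints.
Context {R : realType} {n : nat} {I : finType}.
Implicit Types g : I -> 'rV[R]_n -> \bar R.

Definition feasible_set g : set 'rV[R]_n :=
  [set x | forall j, (g j x <= 0)%E].

(* I(x) *)
Definition active_set g (x : 'rV[R]_n) : {set I} :=
  [set j | g j x == 0%E]%SET.

End Constraints.

(* Main.v *)
Require Import Defs.
From HB Require Import structures.
From mathcomp Require Import all_boot all_order all_algebra.
From mathcomp Require Import all_classical all_reals all_analysis.
From mathcomp Require Import ring lra.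
Import Order.TTheory GRing.Theory Num.Theory.
Import numFieldNormedType.Exports.
Local Open Scope classical_set_scope.
Local Open Scope ring_scope.

(* Pair the stationarity identity with y - xbar.  Both y and xbar lie in every
   K_j with g_j(y) <= 0 = g_j(xbar); dividing the strong subgradient inequality
   by lambda and letting lambda tend to 0 gives
   <v_j, y - xbar> <= - beta_j gamma_j / 2 |y - xbar|^2.
   For a horizon subgradient v_j^oo = lim t_k v^k with v^k a regular subgradient
   at x^k, inner semicontinuity provides y^k -> y with g_j(y^k) <= g_j(x^k);
   g_j does not exceed g_j(x^k) on the segment from x^k to y^k, so
   <v^k, y^k - x^k> <= 0, and in the limit <v_j^oo, y - xbar> <= 0.
   Nothing here is local, so V is the whole space. *)

Section Dot.
Set Implicit Arguments.
Unset Strict Implicit.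
Context {R : realType} {n : nat}.
Implicit Types u v w : 'rV[R]_n.

Lemma dotDl u v w : dot (u + v) w = dot u w + dot v w.
Proof.
by rewrite /dot -big_split; apply: eq_bigr => i _; rewrite mxE mulrDl.
Qed.

Lemma dotZl (a : R) u w : dot (a *: u) w = a * dot u w.
Proof.
by rewrite /dot mulr_sumr; apply: eq_bigr => i _; rewrite mxE mulrA.
Qed.

Lemma dotZr (a : R) u w : dot u (a *: w) = a * dot u w.
Proof.
by rewrite /dot mulr_sumr; apply: eq_bigr => i _; rewrite mxE mulrCA.
Qed.

Lemma dot0l w : dot 0 w = 0.
Proof. by rewrite /dot big1 // => i _; rewrite mxE mul0r. Qed.

Lemma dot_suml (J : finType) (P : pred J) (F : J -> 'rV[R]_n) w :
  dot (\sum_(j | P j) F j) w = \sum_(j | P j) dot (F j) w.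
Proof.
by apply: (big_morph (fun u => dot u w)) => [u v|]; rewrite ?dotDl ?dot0l.
Qed.

Lemma enormZ (a : R) u : 0 <= a -> enorm (a *: u) = a * enorm u.
Proof.
move=> a0; rewrite /enorm dotZl dotZr mulrA -expr2 sqrtrM ?sqr_ge0//.
by rewrite sqrtr_sqr ger0_norm.
Qed.

Lemma cvg_dot (u_ v_ : nat -> 'rV[R]_n) u v :
  u_ @ \oo --> u -> v_ @ \oo --> v ->
  (fun k => dot (u_ k) (v_ k)) @ \oo --> dot u v.
Proof.
move=> uu vv; apply: cvg_big => [|i _]; first exact: add_continuous.
apply: cvgM.
- exact: (continuous_cvg _ (@coord_continuous R 1 n 0 i u) uu).
- exact: (continuous_cvg _ (@coord_continuous R 1 n 0 i v) vv).
Qed.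

End Dot.

(** Replaces a passage to the limit [l -> 0+]. If [a > 0], then [l = 1] gives [c >= a > 0], so
    [l = a / (2 * c)] is admissible and yields [a <= a / 2], which is absurd. *)
Lemma le0_of_le_mul_small {R : realFieldType} (a c : R) :
  0 <= c -> (forall l, 0 < l <= 1 -> a <= l * c) -> a <= 0.
Proof.
move=> c0 H; rewrite leNgt; apply/negP => a0.
have ac : a <= c by rewrite -[c]mul1r; apply: H; rewrite ltr01 lexx.
have cp : 0 < c by exact: lt_le_trans ac.
have : a <= a / (2 * c) * c.
  apply: H; rewrite divr_gt0 ?mulr_gt0//= ler_pdivrMr ?mulr_gt0//; lra.
by rewrite invfM mulrA mulfVK ?gt_eqF//; lra.
Qed.

Section Subgradients.
Set Implicit Arguments.
Unset Strict Implicit.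
Context {R : realType} {n : nat}.
Implicit Types (h : 'rV[R]_n -> \bar R) (x y v xi : 'rV[R]_n).

Lemma strong_subdiff_le (K : set 'rV[R]_n) (beta gamma : R) h x xi y :
  0 < beta -> 0 <= gamma -> h x \is a fin_num ->
  strong_subdiff K beta gamma h x xi -> K y -> (h y <= h x)%E ->
  dot xi (y - x) <= - (beta * gamma / 2 * enorm (y - x) ^+ 2).
Proof.
move=> b0 g0 hfin [_ _ H] Ky hyx.
set a := dot _ _; set q := _ ^+ 2.
have q0 : 0 <= q by exact: sqr_ge0.
have small : a + beta * gamma / 2 * q <= 0.
  (* Multiplying the increment in the subgradient inequality by [beta / l] gives [a + beta * gamma /
     2 * q - l * ((1 + beta * gamma) * q / 2)]; the constant is the coefficient of [l]. *)
  apply: (@le0_of_le_mul_small _ _ ((1 + beta * gamma) * q / 2)).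
    by rewrite divr_ge0// mulr_ge0// addr_ge0// mulr_ge0// ltW.
  move=> l /andP[l0 l1].
  have := H y l Ky; rewrite (ltW l0) l1 => /(_ isT).
  rewrite (max_idPr hyx) -/a -/q -[leRHS]adde0 leeD2lE// lee_fin => Hl.
  have : l / beta * (a + beta * gamma / 2 * q
                     - l * ((1 + beta * gamma) * q / 2)) <= 0.
    apply: le_trans Hl; rewrite le_eqVlt; apply/orP; left; apply/eqP.
    by field; rewrite gt_eqF.
  by rewrite pmulr_rle0 ?divr_gt0// subr_le0.
lra.
Qed.

(** At a point at parameter [l] on the segment from [x] to [y], the linear term [l * dot v (y - x)]
    is at most [- r], hence at most [e * l * enorm (y - x)] for small [l]. Dividing by [l] leaves
    only the arbitrary tolerance [e]. *)
Lemma regular_subdiff_le0 (gamma : R) h x y v :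
  0 <= gamma -> proper_fun h -> strongly_quasiconvex gamma h ->
  regular_subdiff h x v -> (h y <= h x)%E -> dot v (y - x) <= 0.
Proof.
move=> g0 [_ hNy] [_ sqc] [hx [r [rsmall hr]]] hyx.
have hfin : h x \is a fin_num by rewrite fin_numElt hNy hx.
have hy : dom h y by exact: le_lt_trans hx.
(* The parameter sent to 0 is the tolerance [e] of the remainder. For fixed [e], a single small [l]
   suffices. *)
apply: (@le0_of_le_mul_small _ _ (enorm (y - x))); first exact: sqrtr_ge0.
move=> e /andP[e0 _].
pose z (l : R) := l *: y + (1 - l) *: x.
have zE l : z l - x = l *: (y - x).
  by rewrite /z scalerBr scalerBl scale1r addrA addrAC addrK.
have zx : z l @[l --> (0 : R)^'+] --> x.
  have -> : x = 0 *: y + (1 - 0) *: x by rewrite scale0r subr0 scale1r add0r.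
  apply: cvg_at_right_filter; apply: cvgD; apply: cvgZr_tmp => //.
  by apply: cvgB => //; exact: cvg_cst.
have rz := zx _ (rsmall _ e0).
have [l [l0 l1 rl]] : exists l : R, [/\ 0 < l, l <= 1
    & (`|r (z l)| <= (e * enorm (z l - x))%:E)%E].
  near (0 : R)^'+ => l; exists l; split.
  - by near: l; exact: nbhs_right_gt.
  - by near: l; exact: nbhs_right_le.
  - by near: l.
have hz : (h (z l) <= h x)%E.
  (* The maximum is [h x], and the modulus term is dropped by its sign. *)
  have := sqc x y l hx hy; rewrite (ltW l0) l1 => /(_ isT) /le_trans; apply.
  rewrite (max_idPr hyx) -[leRHS]sube0 leeB// lee_fin.
  by rewrite !mulr_ge0 ?subr_ge0 ?invr_ge0 ?(ltW l0) ?sqrtr_ge0.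
have := le_trans (hr (z l)) hz.
rewrite -addeA -[leRHS]adde0 leeD2lE//.
(* The remainder is extended-valued, but its bound at [z l] makes it finite there, so the rest is
   real arithmetic. *)
have rfin : r (z l) \is a fin_num.
  by rewrite -abse_fin_num ge0_fin_numE// (le_lt_trans rl)// ltry.
move: rl; rewrite -(fineK rfin) -EFinD !lee_fin zE dotZr enormZ ?(ltW l0)// => rl H.
rewrite -(ler_pM2l l0) mulrCA.
move: rl; rewrite ler_norml => /andP[rl _].
lra.
Unshelve. all: by end_near.
Qed.

Lemma horizon_subdiff_le0 (gamma : R) h x y v :
  0 <= gamma -> proper_fun h -> strongly_quasiconvex gamma h ->
  sublevel_inner_semicontinuous h x ->
  horizon_subdiff h x v -> (h y <= h x)%E -> dot v (y - x) <= 0.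
Proof.
move=> g0 hp hq hisc [x_ [v_ [t_ [[xx _] vr t0 _ tv]]]] hyx.
have [y_ [yy hyx_]] := hisc y hyx x_ xx (fun k => (vr k).1).
have dcvg : (fun k => dot (t_ k *: v_ k) (y_ k - x_ k)) @ \oo --> dot v (y - x).
  exact: cvg_dot tv (cvgB yy xx).
(* The sign is checked before the limit: the factor [t_ k > 0] preserves it. *)
apply: (cvgr_to_le dcvg).
apply: nearW => k; rewrite dotZl pmulr_rle0//.
exact: (regular_subdiff_le0 g0 hp hq (vr k) (hyx_ k)).
Qed.

End Subgradients.

Theorem theorem6 (R : realType) (n : nat) (I : finType)
  (f : 'rV[R]_n -> \bar R) (g : I -> 'rV[R]_n -> \bar R)
  (Omega_closed : closed (feasible_set g))
  (Omega_convex : convex_set (feasible_set g))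
  (xbar : 'rV[R]_n)
  (xbar_Omega : feasible_set g xbar) (xbar_dom : dom f xbar)
  (K : I -> set 'rV[R]_n) (beta gamma : I -> R)
  (beta_gt0 : forall j, 0 < beta j) (gamma_ge0 : forall j, 0 <= gamma j)
  (gamma0 : R) (mu : I -> R) (v vinf : 'rV[R]_n) (w winf : I -> 'rV[R]_n)
  (gamma0_ge0 : 0 <= gamma0)
  (mu_ge0 : forall j, j \in active_set g xbar -> 0 <= mu j)
  (v_sub : limiting_subdiff f xbar v)
  (vinf_sub : horizon_subdiff f xbar vinf)
  (w_sub : forall j, j \in active_set g xbar -> 0 < mu j ->
     strong_subdiff (K j) (beta j) (gamma j) (g j) xbar (w j))
  (winf_sub : forall j, j \in active_set g xbar -> mu j = 0 ->
     horizon_subdiff (g j) xbar (winf j))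
  (multipliers_sum : gamma0 + \sum_(j in active_set g xbar) mu j = 1)
  (gamma0hat : R) (gamma0hatE : gamma0hat = if gamma0 == 0 then 1 else 0)
  (stationarity :
     0 = gamma0 *: v + gamma0hat *: vinf
         + \sum_(j in active_set g xbar | 0 < mu j) mu j *: w j
         + \sum_(j in active_set g xbar | mu j == 0) winf j)
  (Omega_sub_K :
     feasible_set g `<=` \bigcap_(j in [set` active_set g xbar]) K j)
  (g_proper : forall j, j \in active_set g xbar -> proper_fun (g j))
  (g_sqc : forall j, j \in active_set g xbar ->
     strongly_quasiconvex (gamma j) (g j))
  (g_isc : forall j, j \in active_set g xbar ->
     sublevel_inner_semicontinuous (g j) xbar)
  (mubar : R)
  (mubarE : mubar = 2^-1 * \sum_(j in active_set g xbar | 0 < mu j)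
                             beta j * gamma j * mu j) :
  exists V : set 'rV[R]_n,
    [/\ open V, convex_set V, V xbar,
        forall y, (feasible_set g `&` V) y ->
          mubar * enorm (y - xbar) ^+ 2
          <= gamma0 * dot v (y - xbar) + gamma0hat * dot vinf (y - xbar) &
        0 < gamma0 ->
        forall y, (feasible_set g `&` V) y ->
          gamma0^-1 * mubar * enorm (y - xbar) ^+ 2 <= dot v (y - xbar)].
Proof.
have main y : feasible_set g y -> mubar * enorm (y - xbar) ^+ 2
    <= gamma0 * dot v (y - xbar) + gamma0hat * dot vinf (y - xbar).
  move=> yO; set d := y - xbar.
  have gx j : j \in active_set g xbar -> g j xbar = 0%E.
    by rewrite inE => /eqP.
  have gyx j : j \in active_set g xbar -> (g j y <= g j xbar)%E.
    by move=> /gx ->; exact: yO.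
  have := congr1 (fun u => dot u d) stationarity.
  rewrite dot0l !dotDl !dotZl !dot_suml => /esym/eqP.
  (* The objective terms equal minus the two constraint sums, so it remains to bound each of these
     from above. *)
  rewrite -addrA addr_eq0 => /eqP ->; rewrite opprD.
  have inf_le0 : \sum_(j in active_set g xbar | mu j == 0) dot (winf j) d <= 0.
    apply: sumr_le0 => j /andP[jA /eqP muj].
    exact: (horizon_subdiff_le0 (gamma_ge0 j) (g_proper _ jA) (g_sqc _ jA)
      (g_isc _ jA) (winf_sub _ jA muj) (gyx _ jA)).
  have w_le : \sum_(j in active_set g xbar | 0 < mu j) dot (mu j *: w j) d
      <= - (mubar * enorm d ^+ 2).
    (* Once [mubar] is expanded, the bound holds term by term: it is the estimate for [w j] scaled
       by [mu j]. *)
    rewrite mubarE mulr_sumr mulr_suml -sumrN; apply: ler_sum => j /andP[jA muj].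
    have Kj : K j y by exact: (Omega_sub_K _ yO).
    have gfin : g j xbar \is a fin_num by rewrite (gx _ jA).
    have := strong_subdiff_le (beta_gt0 j) (gamma_ge0 j) gfin
      (w_sub _ jA muj) Kj (gyx _ jA).
    rewrite -/d dotZl => /(ler_wpM2l (ltW muj)) /le_trans; apply.
    lra.
  lra.
exists setT; split => //.
- exact: openT.
- by move=> y [yO _]; exact: main.
move=> gamma0_gt0 y [/main + _].
(* Here [gamma0hat = 0], so the horizon term vanishes and dividing by [gamma0] is legitimate. *)
by rewrite gamma0hatE gt_eqF// mul0r addr0 -mulrA ler_pdivrMl.
Qed.
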